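(* Consider an infinite stream of hypotheses $H_1,H_2,\dots$ with p-values $p_1,p_2,\dots$ and set of null indices $\mathcal H_0$. Fix $a>0$ and let $\alpha_1,\alpha_2,\dots$ be any sequence of thresholds predictable with respect to a filtration $\mathcal G_k$, in the sense that $$\alpha_{k+1}\in\mathcal G_k\supseteq\sigma\left(I(p_j\le\alpha_j);\ j\le k\right),$$ that is, $\alpha_{k+1}$ is $\mathcal G_k$-measurable and $\mathcal G_k$ contains the past rejection indicators. Let $\mathcal R_k\equiv\{j\le k:p_j\le\alpha_j\}$. Suppose the null p-values are stochastically larger than uniform conditional on the past: $$\Pr\{p_k\le s\mid\mathcal G_{k-1}\}\le s\quad\text{for each }k\in\mathcal H_0\text{ and each }s\in[0,1].$$ 1. Define $$\overline V_{\text{online-simple}}(\mathcal R_k)\equiv\left\lfloor\frac{\log(\frac1\alpha)}{a\log\left(1+\frac{\log(\frac1\alpha)}{a}\right)}\cdot\left(a+\sum_{j=1}^k\alpha_j\right)\right\rfloor,\qquad \overline{\mathrm{FDP}}_{\text{online-simple}}(\mathcal R_k)\equiv\frac{\overline V_{\text{online-simple}}(\mathcal R_k)}{|\mathcal R_k|}.$$ Then for all $\alpha\in(0,1)$, $$\Pr\left\{\mathrm{FDP}(\mathcal R_k)\le\overline{\mathrm{FDP}}_{\text{online-simple}}(\mathcal R_k)\ \text{for all }k\ge0\right\}\ge1-\alpha.$$ 2. Let $\lambda_j\ge\alpha_j$ for all $j$, let $\{\lambda_j\}$ be predictable with respect to $\mathcal G_k$ (that is, $\lambda_{k+1}$ is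 $\mathcal G_k$-measurable), and let $\sup_j\frac{\alpha_j}{1-\lambda_j}\equiv B<\infty$. Define $$\overline V^{B}_{\text{online-adaptive}}(\mathcal R_k)\equiv\left\lfloor\frac{\log(\frac1\alpha)}{a\log\left(1+\frac{1-\alpha^{B/a}}{B}\right)}\cdot\left(a+\sum_{j=1}^k\frac{\alpha_j}{1-\lambda_j}I(p_j>\lambda_j)\right)\right\rfloor,\qquad\overline{\mathrm{FDP}}_{\text{online-adaptive}}(\mathcal R_k)\equiv\frac{\overline V^{B}_{\text{online-adaptive}}(\mathcal R_k)}{|\mathcal R_k|}.$$ Then for all $\alpha\in(0,1)$, $$\Pr\left\{\mathrm{FDP}(\mathcal R_k)\le\overline{\mathrm{FDP}}_{\text{online-adaptive}}(\mathcal R_k)\ \text{for all }k\ge0\right\}\ge1-\alpha.$$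
   Context: The p-values are $[0,1]$-valued random variables on a common probability space. For a finite set $\mathcal R$ of indices, $\mathrm{FDP}(\mathcal R)\equiv|\mathcal R\cap\mathcal H_0|/|\mathcal R|$, with $\mathrm{FDP}(\varnothing)\equiv0$; when $\mathcal R_k=\varnothing$ the inequality $\mathrm{FDP}(\mathcal R_k)\le\overline{\mathrm{FDP}}(\mathcal R_k)$ is regarded as holding trivially. In part 2, $\lambda_j<1$ is implicit in the formulas and $B$ is a constant. $I(\cdot)$ is the indicator, $\lfloor\cdot\rfloor$ the floor function, $\log$ the natural logarithm. Here $\alpha$ (no subscript) is the confidence parameter and is unrelated to the thresholds $\alpha_j$.
   Formalization: In part 2 the indicators I(p_j > λ_j), j ≤ k, are additionally assumed G_k-measurable (without this the adaptive bound can fail), and the thresholds α_j are assumed nonnegative throughout. *)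

(* Defs.v *)
From HB Require Import structures.
From mathcomp Require Import all_boot all_order all_algebra.
From mathcomp Require Import all_classical all_reals all_analysis.

Set Implicit Arguments.
Unset Strict Implicit.
Unset Printing Implicit Defensive.

Import Order.TTheory GRing.Theory Num.Theory.
Import numFieldNormedType.Exports.

Local Open Scope classical_set_scope.
Local Open Scope ring_scope.

(* Index convention: the stream is indexed from 0, so that [p j], [alpha j],
   [lambda j] stand for p_(j+1), alpha_(j+1), lambda_(j+1), and the first k
   hypotheses are those with j < k.  The sigma-algebra [G k] is the information
   available after the first k hypotheses, so "alpha_(k+1) is G_k-measurable"
   reads "[alpha k] is [G k]-measurable". *)

Section Conditioning.
Context d (T : measurableType d) (R : realType).

Definition filtration (G : nat -> set (set T)) : Prop :=
  [/\ forall k, sigma_algebra setT (G k),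
      forall k, G k `<=` measurable &
      forall k l, (k <= l)%N -> G k `<=` G l].

Definition measurable_wrt (F : set (set T)) (X : T -> R) : Prop :=
  preimage_set_system setT X measurable `<=` F.

Definition predictable (G : nat -> set (set T)) (X : nat -> T -> R) : Prop :=
  forall k, measurable_wrt (G k) (X k).

Definition cond_prob_version (P : probability T R) (F : set (set T))
    (E : set T) (q : T -> R) : Prop :=
  [/\ measurable_wrt F q,
      P.-integrable setT (EFin \o q) &
      forall A, F A -> (\int[P]_(w in A) (q w)%:E = P (E `&` A))%E].

(* Versions of P(E | F) agree almost surely, so it does not matter which one
   is used. *)
Definition cond_prob_le (P : probability T R) (F : set (set T))
    (E : set T) (s : R) : Prop :=
  exists2 q, cond_prob_version P F E q & {ae P, forall w, q w <= s}.

End Conditioning.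

Section OnlineTesting.
Context {T : Type} {R : realType}.
Implicit Types (p alpha lambda : nat -> T -> R) (k : nat) (w : T).

Definition rejections p alpha k w : {set 'I_k} :=
  [set j : 'I_k | p j w <= alpha j w]%SET.

(* As x / 0 = 0 here, FDP of the empty set is 0; likewise the two bounds below
   are 0 when there is no rejection, so that FDP <= FDPbar then holds. *)
Definition FDP (H0 : set nat) k (S : {set 'I_k}) : R :=
  #|[set j in S | (j : nat) \in H0]%SET|%:R / #|S|%:R.

Definition Vbar_simple (a conf : R) alpha k w : int :=
  Num.floor (ln (1 / conf) / (a * ln (1 + ln (1 / conf) / a))
             * (a + \sum_(j < k) alpha j w)).

Definition FDPbar_simple (a conf : R) p alpha k w : R :=
  (Vbar_simple a conf alpha k w)%:~R / #|rejections p alpha k w|%:R.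

Definition Vbar_adaptive (a B conf : R) p alpha lambda k w : int :=
  Num.floor (ln (1 / conf) / (a * ln (1 + (1 - conf `^ (B / a)) / B))
             * (a + \sum_(j < k) alpha j w / (1 - lambda j w)
                                 * (lambda j w < p j w)%R%:R)).

Definition FDPbar_adaptive (a B conf : R) p alpha lambda k w : R :=
  (Vbar_adaptive a B conf p alpha lambda k w)%:~R
    / #|rejections p alpha k w|%:R.

End OnlineTesting.

(* Main.v *)
Require Import Defs.
From HB Require Import structures.
From mathcomp Require Import all_boot all_order all_algebra.
From mathcomp Require Import all_classical all_reals all_analysis.
From mathcomp Require Import measurable_realfun.
From mathcomp Require Import lra ring.

(** The number V_k of false rejections is controlled by an exponential
supermartingale and Ville's inequality.  Put L = ln (1 / conf).  At each null
index j one subtracts from the gain theta * I(p_j <= alpha_j) a penalty D_j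
chosen so that
  E [exp (theta * I(p_j <= alpha_j) - D_j) | G_j] <= 1.
Then exp (\sum_j (theta * I(p_j <= alpha_j) - D_j)), the sum ranging over the
null j < k, is a nonnegative supermartingale started at 1, so with probability
at least 1 - conf it stays below 1 / conf for all k simultaneously, that is,
theta * V_k < L + \sum_j D_j.  Extending the sum of penalties to the non-null
indices only weakens this bound.

- For the simple bound, D_j = u * alpha_j with u = exp theta - 1: the conditional
  expectation of exp (theta * I(p_j <= alpha_j)) is at most
  1 + u * alpha_j <= exp (u * alpha_j) ([supermartingale_step_simple]).
  Taking u = L / a makes L + \sum_j D_j proportional to a + \sum_j alpha_j.
- For the adaptive bound, D_j = b * x_j * I(p_j > lambda_j), where b = L / a and
  x_j = alpha_j / (1 - lambda_j).  As the events p_j <= alpha_j and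
  p_j > lambda_j are disjoint, the exponential is
    1 + u * I(p_j <= alpha_j) - (1 - exp (- b * x_j)) * I(p_j > lambda_j),
  of conditional expectation at most 1 as soon as
  u * x_j <= 1 - exp (- b * x_j) ([supermartingale_step_adaptive]).  The right
  side is concave in x_j and x_j ranges over [0, B], so the slope
  u = (1 - exp (- b * B)) / B of the chord will do ([chord_le_1BexpR]); and
  exp (- b * B) = conf `^ (B / a).

No conditional expectation is formed: conditional inequalities are integrated
against nonnegative weights g measurable for the past, over events A of the
past.  The hypothesis on null p-values concerns deterministic levels s;
[le_integral_threshold] carries it over to predictable thresholds by cutting
the range of the threshold into cells of width 1 / n. *)

Set Implicit Arguments.
Unset Strict Implicit.
Unset Printing Implicit Defensive.

Import Order.TTheory GRing.Theory Num.Theory.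
Import numFieldNormedType.Exports.

Local Open Scope classical_set_scope.
Local Open Scope ring_scope.

(** * Integration over a sub-sigma-algebra *)

Section SubSigmaAlgebra.
Context d (T : measurableType d) (R : realType).
Variable F : set (set T).
Hypothesis F_sigma : sigma_algebra setT F.
Hypothesis F_meas : F `<=` measurable.

Lemma sub_measurableE :
  (measurable : set (set (g_sigma_algebraType F))) = F.
Proof. exact: sigma_algebra_id. Qed.

(** Equipping [T] with [F] as its measurable structure makes the closure
properties of measurable functions available for [F]-measurability. *)
Lemma measurable_wrtP (X : T -> R) :
  measurable_wrt F X <->
  measurable_fun (setT : set (g_sigma_algebraType F)) X.
Proof.
split=> [XF _ Y mY | mX A [Y mY <-]].
  by rewrite sub_measurableE; apply: XF; exists Y.
by rewrite -[F]sub_measurableE; exact: mX.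
Qed.

Lemma measurable_fun_id_sub :
  measurable_fun setT (idfun : T -> g_sigma_algebraType F).
Proof.
move=> _ A mA; rewrite setTI; apply: F_meas.
by rewrite -[F]sub_measurableE.
Qed.

Lemma measurable_fun_sub d' (U : measurableType d') (f : T -> U) :
  measurable_fun (setT : set (g_sigma_algebraType F)) f ->
  measurable_fun setT f.
Proof.
move=> mf _ Y mY; apply: F_meas; rewrite -[X in X _]sub_measurableE.
exact: mf.
Qed.

(** On [F] the measure [P (_ `&` E)] is dominated by [s * P]; the integrals of an
[F]-measurable function only see the images of these two measures under the
identity map to [T] equipped with [F], so they compare in the same way. *)
Lemma le_integral_fixed_event (P : {measure set T -> \bar R}) (E : set T)
    (s : R) (g : T -> R) (A : set T) :
  measurable E -> 0 <= s ->
  (forall A', F A' -> (P (A' `&` E) <= s%:E * P A')%E) ->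
  (forall w, 0 <= g w) ->
  measurable_fun (setT : set (g_sigma_algebraType F)) g ->
  F A ->
  (\int[P]_(w in A `&` E) (g w)%:E <= s%:E * \int[P]_(w in A) (g w)%:E)%E.
Proof.
move=> mE s0 PE g0 mg FA.
have mA : measurable A by exact: F_meas.
have mgT : measurable_fun setT (EFin \o g).
  by apply/measurable_EFinP; exact: measurable_fun_sub.
have mg' : measurable_fun (setT : set (g_sigma_algebraType F)) (EFin \o g).
  exact/measurable_EFinP.
have mid := measurable_fun_id_sub.
have mA' : measurable (A : set (g_sigma_algebraType F)).
  by rewrite sub_measurableE.
pose m1 : {measure set (g_sigma_algebraType F) -> \bar R} :=
  pushforward (mrestr P mE) (idfun : T -> g_sigma_algebraType F).
pose m0 : {measure set (g_sigma_algebraType F) -> \bar R} :=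
  pushforward P (idfun : T -> g_sigma_algebraType F).
pose m2 : {measure set (g_sigma_algebraType F) -> \bar R} :=
  mscale (NngNum s0) (m0 mid).
have -> : (\int[P]_(w in A `&` E) (g w)%:E =
          \int[mrestr P mE]_(w in A `&` E) (g w)%:E)%E.
  apply: eq_measure_integral => B mB BAE.
  by rewrite /= /mrestr setIidl// => x /BAE[].
apply: (@le_trans _ _ (\int[mrestr P mE]_(w in A) (g w)%:E)%E).
  apply: ge0_subset_integral => //.
  - exact: measurableI.
  - exact: measurable_funTS.
  - by move=> w _; rewrite lee_fin.
have mgA : measurable_fun (A : set (g_sigma_algebraType F)) (EFin \o g).
  exact: measurable_funTS.
have g0A w : A w -> (0 <= (EFin \o g) w)%E by rewrite lee_fin.
have g0A' : {in A, forall w, (0 <= (EFin \o g) w)%E}.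
  by move=> w _; rewrite lee_fin.
rewrite -[in leLHS](ge0_integral_pushforward mid _ mA' mgA g0A').
rewrite -[in leRHS](ge0_integral_pushforward mid _ mA' mgA g0A').
rewrite -(ge0_integral_mscale (m0 mid) mA' (NngNum s0) mgA g0A).
apply: (@ge0_le_measure_integral _ _ R (m1 mid) m2) => // S.
rewrite sub_measurableE => FS.
by rewrite /= /mscale/= /pushforward/= /mrestr; exact: PE.
Qed.

End SubSigmaAlgebra.

(** * Superuniformity at a predictable threshold *)

Section RandomThreshold.
Context d (T : measurableType d) (R : realType) (P : {measure set T -> \bar R}).
Variable F : set (set T).
Hypothesis F_sigma : sigma_algebra setT F.
Hypothesis F_meas : F `<=` measurable.
Variable X : T -> R.
Hypothesis mX : measurable_fun setT X.
Hypothesis superuniform : forall s : R, 0 <= s -> forall A, F A ->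
  (P (A `&` [set w | (X w <= s)%R]) <= s%:E * P A)%E.
Variables (g t : T -> R) (A : set T).
Hypothesis g0 : forall w, 0 <= g w.
Hypothesis mg : measurable_fun (setT : set (g_sigma_algebraType F)) g.
Hypothesis t0 : forall w, 0 <= t w.
Hypothesis mt : measurable_fun (setT : set (g_sigma_algebraType F)) t.
Hypothesis FA : F A.

Let mA : measurable A. Proof. exact: F_meas. Qed.
Let mgT : measurable_fun setT g. Proof. exact: (measurable_fun_sub F_sigma). Qed.
Let mtT : measurable_fun setT t. Proof. exact: (measurable_fun_sub F_sigma). Qed.

Let mle (f : T -> R) : measurable_fun setT f -> measurable [set w | X w <= f w].
Proof.
by move=> mf; rewrite -[X in measurable X]setTI; exact: measurable_fun_le.
Qed.

(** On the cell where [i <= n * t < i + 1] the threshold can be replaced by the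
constant [(i + 1) / n], which exceeds [t] by at most [1 / n] there. *)
Lemma le_integral_threshold_eps n : (0 < n)%N ->
  (\int[P]_(w in A `&` [set w | (X w <= t w)%R]) (g w)%:E <=
   \int[P]_(w in A) (g w * (t w + n%:R^-1))%:E)%E.
Proof.
move=> n0; have nR0 : 0 < n%:R :> R by rewrite ltr0n.
pose cell i := A `&` [set w | (i%:R <= t w * n%:R < i.+1%:R)%R].
have cellE i : cell i =
    A `&` (fun w => Num.trunc (t w * n%:R)) @^-1` [set i].
  apply/seteqP; split=> w [Aw] /=.
    by move=> h; split=> //; exact: truncn_def.
  by move=> <-; split=> //; apply: truncn_itv; rewrite mulr_ge0.
have cellU : A = \bigcup_i cell i.
  apply/seteqP; split=> [w Aw|w [i _ []]//].
  by exists (Num.trunc (t w * n%:R)) => //; rewrite cellE.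
have Fcell i : F (cell i).
  rewrite -[F](sub_measurableE F_sigma).
  have -> : cell i = A `&` ([set w | i%:R <= t w * n%:R] `&`
                            [set w | t w * n%:R < i.+1%:R]).
    congr (_ `&` _); apply/seteqP.
    by split=> [w /= /andP[]//|w /= [-> ->]].
  apply: measurableI; first by rewrite (sub_measurableE F_sigma).
  have mtn : measurable_fun (setT : set (g_sigma_algebraType F))
      (fun w => t w * n%:R) by exact: measurable_funM.
  apply: measurableI.
    rewrite -[X in measurable X]setTI.
    by apply: measurable_fun_le.
  rewrite -[X in measurable X]setTI.
  have := @measurable_fun_ltr _ _ R setT _ _ mtn (measurable_cst (i.+1%:R : R)).
  by move=> /(_ measurableT [set true]); apply.
have cellI : trivIset setT cell.
  rewrite (_ : cell = fun i =>
    A `&` (fun w => Num.trunc (t w * n%:R)) @^-1` [set i]); last first.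
    by apply/funext => i; exact: cellE.
  exact: trivIset_preimage1_in.
have mg' : measurable_fun setT (EFin \o g) by exact/measurable_EFinP.
have mh : measurable_fun setT (EFin \o (fun w => g w * (t w + n%:R^-1))).
  by apply/measurable_EFinP/measurable_funM => //; exact: measurable_funD.
have h0 w : 0 <= g w * (t w + n%:R^-1).
  by rewrite mulr_ge0// addr_ge0// invr_ge0 ltW.
have -> : A `&` [set w | X w <= t w] =
    \bigcup_i (cell i `&` [set w | X w <= t w]).
  by rewrite -setI_bigcupl -cellU.
rewrite [in leRHS]cellU !ge0_integral_bigcup//=; first last.
- by apply: trivIset_setIr; exact: cellI.
- by move=> w _; rewrite lee_fin.
- exact: measurable_funTS.
- by move=> i; apply: measurableI; [exact: F_meas|exact: mle].
- by move=> w _; rewrite lee_fin.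
- exact: measurable_funTS.
- by move=> i; exact: F_meas.
apply: lee_nneseries => [i _ _|i _].
  by apply: integral_ge0 => w _; rewrite lee_fin.
have mcell : measurable (cell i) by exact: F_meas.
apply: (@le_trans _ _ (\int[P]_(w in cell i `&` [set w | (X w <= i.+1%:R / n%:R)%R])
  (g w)%:E)%E).
  apply: ge0_subset_integral.
  - by apply: measurableI => //; exact: mle.
  - by apply: measurableI => //; apply: mle; exact: measurable_cst.
  - exact: measurable_funTS.
  - by move=> w _; rewrite lee_fin.
  move=> w /= [[Aw /andP[iw wi]] Xw]; split; first by split=> //; apply/andP.
  by rewrite (le_trans Xw)// ler_pdivlMr// ltW.
have si : 0 <= i.+1%:R / n%:R :> R by rewrite divr_ge0.
apply: (le_trans (le_integral_fixed_event F_sigma F_meas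
  (mle (measurable_cst _)) si (superuniform si) g0 mg (Fcell i))).
rewrite -ge0_integralZl_EFin//; first last.
- exact: measurable_funTS.
- by move=> w _; rewrite lee_fin.
apply: ge0_le_integral => //.
- by move=> w _; rewrite -EFinM lee_fin mulr_ge0.
- apply/measurable_EFinP; apply: measurable_funM => //; exact: measurable_funTS.
- exact: measurable_funTS.
move=> w [_ /= /andP[iw _]]; rewrite -EFinM lee_fin mulrC ler_wpM2l//.
by rewrite ler_pdivrMr// mulrDl mulVf ?gt_eqF// -natr1 lerD2r.
Qed.

Hypothesis g_int : (\int[P]_(w in A) (g w)%:E < +oo)%E.

Lemma le_integral_threshold :
  (\int[P]_(w in A `&` [set w | (X w <= t w)%R]) (g w)%:E <=
   \int[P]_(w in A) (g w * t w)%:E)%E.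
Proof.
have mg' : measurable_fun A (EFin \o g).
  by apply: measurable_funTS; exact/measurable_EFinP.
have igfin : (\int[P]_(w in A) (g w)%:E)%E \is a fin_num.
  by rewrite ge0_fin_numE//; apply: integral_ge0 => w _; rewrite lee_fin.
set c := fine (\int[P]_(w in A) (g w)%:E)%E.
have c0 : 0 <= c.
  by apply: fine_ge0; apply: integral_ge0 => w _; rewrite lee_fin.
apply/lee_addgt0Pr => e e0.
(* this [n] makes the discretization error [c / n] at most [e] *)
pose n := (Num.trunc (c / e)).+1.
have nR0 : 0 < n%:R :> R by [].
apply: (le_trans (@le_integral_threshold_eps n _)) => //.
under eq_integral do rewrite mulrDr EFinD.
rewrite ge0_integralD//; first last.
- by apply: measurable_funTS; apply/measurable_EFinP/measurable_funM.
- by move=> w _; rewrite lee_fin mulr_ge0// invr_ge0 ltW.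
- by apply: measurable_funTS; apply/measurable_EFinP/measurable_funM.
- by move=> w _; rewrite lee_fin mulr_ge0.
rewrite leeD2l//.
under eq_integral do rewrite mulrC EFinM.
rewrite ge0_integralZl_EFin//; last by move=> w _; rewrite lee_fin.
rewrite -(fineK igfin) -/c -EFinM lee_fin mulrC ler_pdivrMr// mulrC.
rewrite -ler_pdivrMr// ltW//.
by have /andP[] := @truncn_itv _ (c / e) (divr_ge0 c0 (ltW e0)).
Qed.

(** Complement of [le_integral_threshold]: the mass of [g] splits over [X <= t]
and [t < X], and its finiteness allows the subtraction. *)
Lemma ge_integral_threshold : (forall w, t w <= 1) ->
  (\int[P]_(w in A) (g w * (1 - t w))%:E <=
   \int[P]_(w in A `&` [set w | (t w < X w)%R]) (g w)%:E)%E.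
Proof.
move=> t1.
have mg' : measurable_fun setT (EFin \o g) by exact/measurable_EFinP.
have igfin : (\int[P]_(w in A) (g w)%:E)%E \is a fin_num.
  by rewrite ge0_fin_numE//; apply: integral_ge0 => w _; rewrite lee_fin.
have mlt : measurable [set w | t w < X w].
  rewrite (_ : [set w | t w < X w] = ~` [set w | X w <= t w]).
    by apply: measurableC; exact: mle.
  by apply/seteqP; split=> w /=; rewrite ltNge => /negP.
have gt_le : (\int[P]_(w in A) (g w * t w)%:E <= \int[P]_(w in A) (g w)%:E)%E.
  apply: ge0_le_integral => //.
  - by move=> w _; rewrite lee_fin mulr_ge0.
  - by apply: measurable_funTS; apply/measurable_EFinP/measurable_funM.
  - exact: measurable_funTS.
  by move=> w _; rewrite lee_fin ler_piMr.
have gt_fin : (\int[P]_(w in A) (g w * t w)%:E)%E \is a fin_num.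
  rewrite ge0_fin_numE ?(le_lt_trans gt_le)//.
  by apply: integral_ge0 => w _; rewrite lee_fin mulr_ge0.
rewrite -(leeD2lE _ _ gt_fin).
rewrite -ge0_integralD//; first last.
- apply: measurable_funTS; apply/measurable_EFinP/measurable_funM => //.
  exact: measurable_funB.
- by move=> w _; rewrite lee_fin mulr_ge0// subr_ge0.
- by apply: measurable_funTS; apply/measurable_EFinP/measurable_funM.
- by move=> w _; rewrite lee_fin mulr_ge0.
under eq_integral do rewrite -EFinD -mulrDr addrC subrK mulr1.
have AE : A = (A `&` [set w | X w <= t w]) `|` (A `&` [set w | t w < X w]).
  rewrite -setIUr -[LHS]setIT; congr (_ `&` _); apply/seteqP; split=> w //= _.
  by case: (leP (X w) (t w)) => ?; [left|right].
rewrite [in leLHS]AE ge0_integral_setU//=.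
- by rewrite leeD2r// le_integral_threshold.
- by apply: measurableI => //; exact: mle.
- exact: measurableI.
- exact: measurable_funTS.
- by move=> w _; rewrite lee_fin.
- apply/disj_setPS => w /= [[_ h1] [_ h2]].
  by move: h2; rewrite ltNge h1.
Qed.

End RandomThreshold.

(** * Ville's inequality *)

Section Ville.
Context d (T : measurableType d) (R : realType) (P : probability T R).
Variable G : nat -> set (set T).
Hypothesis G_filtration : filtration G.
Variable Y : nat -> T -> R.
Hypothesis mY : forall j k, (j < k)%N ->
  measurable_fun (setT : set (g_sigma_algebraType (G k))) (Y j).
Hypothesis supermartingale : forall k (g : T -> R) A, G k A ->
  (forall w, 0 <= g w) ->
  measurable_fun (setT : set (g_sigma_algebraType (G k))) g ->
  (\int[P]_(w in A) (g w)%:E < +oo)%E ->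
  (\int[P]_(w in A) (g w * expR (Y k w))%:E <= \int[P]_(w in A) (g w)%:E)%E.
Variable L : R.
Hypothesis L_gt0 : 0 < L.

Let G_sigma k : sigma_algebra setT (G k).
Proof. by case: G_filtration. Qed.
Let G_meas k : G k `<=` measurable.
Proof. by case: G_filtration. Qed.
Let G_le k l : (k <= l)%N -> G k `<=` G l.
Proof. by case: G_filtration => _ _; exact. Qed.

Let S k w := \sum_(j < k) Y j w.

Let mS k : measurable_fun (setT : set (g_sigma_algebraType (G k))) (S k).
Proof.
apply: measurable_sum => j.
have := mY (ltn_ord j); exact.
Qed.

Let mST k : measurable_fun setT (S k).
Proof. exact: (measurable_fun_sub (@G_sigma k) (@G_meas k)). Qed.

Let below k := [set w | forall j, (j <= k)%N -> S j w < L].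

Let below0 : below 0 = setT.
Proof.
apply/seteqP; split=> // w _ j.
by rewrite leqn0 => /eqP->; rewrite /S big_ord0.
Qed.

Let belowS k : below k.+1 = below k `&` [set w | S k.+1 w < L].
Proof.
apply/seteqP; split=> [w h|w [h1 h2] j].
  by split=> [j jk|]; apply: h => //; exact: leqW.
by rewrite leq_eqVlt => /predU1P[->//|]; exact: h1.
Qed.

Let mlt k : G k [set w | S k w < L].
Proof.
rewrite -[G k](sub_measurableE (@G_sigma k)) -[X in measurable X]setTI.
have := measurable_fun_ltr (@mS k) (measurable_cst L).
by move=> /(_ measurableT [set true]); apply.
Qed.

Let G_setI k A B : G k A -> G k B -> G k (A `&` B).
Proof.
by rewrite -(sub_measurableE (@G_sigma k)); exact: measurableI.
Qed.

Let G_below k : G k (below k).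
Proof.
elim: k => [|k ih].
  rewrite below0 -[G _](sub_measurableE (@G_sigma 0)); exact: measurableT.
by rewrite belowS; apply: G_setI; [exact: G_le ih|exact: mlt].
Qed.

Let m_below k : measurable (below k). Proof. exact: G_meas (G_below k). Qed.

Let m_above k : measurable (below k `&` [set w | L <= S k.+1 w]).
Proof.
apply: measurableI => //; rewrite -[X in measurable X]setTI.
exact: measurable_fun_le.
Qed.

Let mexpS k : measurable_fun setT (fun w => (expR (S k w))%:E).
Proof. by apply/measurable_EFinP; exact: measurableT_comp. Qed.

(* The supermartingale stopped when it first reaches [expR L] has expectation at
   most 1; on the event that the level has been reached, it is bounded below by
   [expR L]. *)
Let stopped_integral_le1 k :
  ((expR L)%:E * P (~` below k) +
    \int[P]_(w in below k) (expR (S k w))%:E <= 1)%E.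
Proof.
elim: k => [|k ih].
  rewrite below0 setCT measure0 mule0 add0e.
  under eq_integral do rewrite /S big_ord0 expR0.
  by rewrite integral_cst//= probability_setT mule1.
have intk_fin : (\int[P]_(w in below k) (expR (S k w))%:E < +oo)%E.
  apply: le_lt_trans (le_trans _ ih) (ltry 1); rewrite leeDr//.
  by rewrite mule_ge0// lee_fin expR_ge0.
apply: le_trans ih.
have step : (\int[P]_(w in below k) (expR (S k.+1 w))%:E <=
             \int[P]_(w in below k) (expR (S k w))%:E)%E.
  under eq_integral do rewrite /S big_ord_recr/= expRD.
  apply: supermartingale => //.
  by apply: measurableT_comp => //; exact: mS.
have UE : below k = below k.+1 `|` (below k `&` [set w | L <= S k.+1 w]).
  rewrite belowS -setIUr -[LHS]setIT; congr (_ `&` _).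
  by apply/seteqP; split=> w //= _; case: (ltP (S k.+1 w) L) => ?; [left|right].
have CE : ~` below k.+1 = ~` below k `|` (below k `&` [set w | L <= S k.+1 w]).
  rewrite belowS setCI; apply/seteqP; split=> w /=.
    case: (pselect (below k w)) => h; last by left.
    by case=> // /negP; rewrite -leNgt; right.
  by case=> [?|[? h]]; [left|right; apply/negP; rewrite -leNgt].
have disj : [disjoint below k.+1 & below k `&` [set w | L <= S k.+1 w]].
  apply/disj_setPS => w /=; rewrite belowS => -[[_ /= h1] [_ h2]].
  by move: h1; rewrite ltNge h2.
have disj' : [disjoint ~` below k & below k `&` [set w | L <= S k.+1 w]].
  by apply/disj_setPS => w /= [h1 [h2 _]].
move: step; rewrite [in leLHS]UE ge0_integral_setU//; last exact: measurable_funTS.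
move=> step; rewrite CE measureU//; [|exact: measurableC|exact/disj_set2P].
rewrite ge0_muleDr//.
rewrite -addeA leeD2l// (le_trans _ step)// addeC leeD2l//.
rewrite -integral_cst//; apply: ge0_le_integral => //.
- by move=> w _; rewrite lee_fin expR_ge0.
- exact: measurable_funTS.
- by move=> w [_ /= h]; rewrite lee_fin ler_expR.
Qed.

Let below_all : [set w | forall k, S k w < L] = \bigcap_k below k.
Proof.
by apply/seteqP; split=> [w h k _ j _|w h k]; [exact: h|exact: (h k I)].
Qed.

Lemma measurable_below_all : measurable [set w | forall k, S k w < L].
Proof. by rewrite below_all; exact: bigcapT_measurable. Qed.

(** Letting [k] go to infinity in the bound [expR L * P (~` below k) <= 1] on the
probability that the level has been reached by time [k]. *)
Lemma ville : ((1 - expR (- L))%:E <= P [set w | forall k, (S k w < L)%R])%E.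
Proof.
have cvP : P (below k) @[k --> \oo] --> P (\bigcap_k below k).
  apply: nonincreasing_cvg_mu => //.
  - by rewrite (le_lt_trans (probability_le1 _ _)) ?ltry.
  - exact: bigcapT_measurable.
  - by move=> m n mn; apply/subsetPset => w h j jm; apply: h; exact: leq_trans mn.
rewrite below_all -(cvg_lim _ cvP)//; apply: lime_ge.
  by apply/cvg_ex; eexists; exact: cvP.
apply: nearW => k.
have h := stopped_integral_le1 k.
rewrite -[X in (_ <= P X)%E]setCK probability_setC; last exact: measurableC.
have PC : P (~` below k) \is a fin_num.
  by apply: fin_num_measure => //; exact: measurableC.
have {h} : ((expR L)%:E * P (~` below k) <= 1)%E.
  apply: (le_trans _ h); rewrite leeDl//; apply: integral_ge0 => w _.
  by rewrite lee_fin expR_ge0.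
rewrite -(fineK PC) -EFinM -EFinB !lee_fin => h.
by rewrite lerD2l lerN2 expRN -[_^-1]mul1r ler_pdivlMr ?expR_gt0// mulrC.
Qed.

End Ville.

(** * One step of the supermartingales *)

Lemma integral_setI_bool d (T : measurableType d) (R : realType)
    (P : {measure set T -> \bar R}) (A : set T) (h : T -> R) (b : T -> bool) :
  (\int[P]_(w in A `&` [set w | b w]) (h w)%:E =
   \int[P]_(w in A) (h w * (b w)%:R)%:E)%E.
Proof.
rewrite integral_mkcondr; apply: eq_integral => w _; rewrite patchE.
have -> : (w \in [set w | b w]) = b w by apply/idP/idP; rewrite inE.
by case: (b w); rewrite ?mulr1 ?mulr0.
Qed.

Lemma expR_ln_bool (R : realType) (u : R) (b : bool) : 0 <= u ->
  expR (ln (1 + u) * b%:R) = 1 + u * b%:R.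
Proof.
move=> u0; case: b; rewrite ?mulr1 ?mulr0 ?addr0 ?expR0// lnK// posrE.
by rewrite ltr_pwDl.
Qed.

Section OneStep.
Context d (T : measurableType d) (R : realType) (P : {measure set T -> \bar R}).
Variable F : set (set T).
Hypothesis F_sigma : sigma_algebra setT F.
Hypothesis F_meas : F `<=` measurable.
Variable X : T -> R.
Hypothesis mX : measurable_fun setT X.
Hypothesis superuniform : forall s : R, 0 <= s -> forall A, F A ->
  (P (A `&` [set w | (X w <= s)%R]) <= s%:E * P A)%E.
Variables (g t : T -> R) (A : set T).
Hypothesis g0 : forall w, 0 <= g w.
Hypothesis mg : measurable_fun (setT : set (g_sigma_algebraType F)) g.
Hypothesis t0 : forall w, 0 <= t w.
Hypothesis mt : measurable_fun (setT : set (g_sigma_algebraType F)) t.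
Hypothesis FA : F A.
Hypothesis g_int : (\int[P]_(w in A) (g w)%:E < +oo)%E.
Variable u : R.
Hypothesis u0 : 0 <= u.

Let mA : measurable A. Proof. exact: F_meas. Qed.
Let mgT : measurable_fun setT g. Proof. exact: (measurable_fun_sub F_sigma). Qed.
Let mtT : measurable_fun setT t. Proof. exact: (measurable_fun_sub F_sigma). Qed.

Let mbool (b : T -> bool) : measurable_fun setT b ->
  measurable_fun setT (fun w => (b w)%:R : R).
Proof.
move=> mb; rewrite (_ : (fun w => _) = (fun w => if b w then 1 else 0)).
  exact: measurable_fun_ifT.
by apply/funext => w; case: (b w).
Qed.

Let mAE (f : T -> R) : measurable_fun setT f ->
  measurable_fun A (fun w => (f w)%:E).
Proof. by move=> mf; apply: measurable_funTS; exact/measurable_EFinP. Qed.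

(* Superuniformity allows the indicator of rejection to be replaced by the
   threshold [t], under the integral against a weight measurable for [F]. *)
Let integral_reward_le (h : T -> R) : (forall w, 0 <= h w) ->
  measurable_fun (setT : set (g_sigma_algebraType F)) h ->
  (\int[P]_(w in A) (h w)%:E < +oo)%E ->
  (\int[P]_(w in A) (h w * (1 + u * (X w <= t w)%R%:R))%:E <=
   \int[P]_(w in A) (h w * (1 + u * t w))%:E)%E.
Proof.
move=> h0 mh h_int.
have mhT : measurable_fun setT h by exact: (measurable_fun_sub F_sigma).
have mb : measurable_fun setT (fun w => (X w <= t w)%R%:R : R).
  by apply: mbool; exact: measurable_fun_ler.
have split_int (f : T -> R) : measurable_fun setT f -> (forall w, 0 <= f w) ->
    (\int[P]_(w in A) (h w * (1 + u * f w))%:E =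
     \int[P]_(w in A) (h w)%:E + u%:E * \int[P]_(w in A) (h w * f w)%:E)%E.
  move=> mf f0; rewrite -ge0_integralZl_EFin//; first last.
  - by apply: mAE; exact: measurable_funM.
  - by move=> w _; rewrite lee_fin mulr_ge0.
  rewrite -ge0_integralD//; first last.
  - apply: (@mAE (fun w => u * (h w * f w))).
    by apply: measurable_funM => //; exact: measurable_funM.
  - by move=> w _; rewrite lee_fin !mulr_ge0.
  - exact: mAE.
  - by move=> w _; rewrite lee_fin.
  apply: eq_integral => w _; rewrite -EFinM -EFinD mulrDr mulr1.
  by rewrite mulrCA.
rewrite !split_int// leeD2l// lee_wpmul2l ?lee_fin//.
rewrite -(integral_setI_bool P A h (fun w => X w <= t w)).
exact: (le_integral_threshold F_sigma F_meas mX superuniform).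
Qed.

(** The penalty [u * t] is known in advance, so [expR (- (u * t))] can be absorbed
into the weight; what remains is [1 + u * t <= expR (u * t)]. *)
Lemma supermartingale_step_simple :
  (\int[P]_(w in A)
     (g w * expR (ln (1 + u) * (X w <= t w)%R%:R - u * t w))%:E <=
   \int[P]_(w in A) (g w)%:E)%E.
Proof.
pose h w := g w * expR (- (u * t w)).
have h0 w : 0 <= h w by rewrite mulr_ge0// expR_ge0.
have mh : measurable_fun (setT : set (g_sigma_algebraType F)) h.
  apply: measurable_funM => //; apply: measurableT_comp => //.
  by apply: measurableT_comp => //; exact: measurable_funM.
have mhT : measurable_fun setT h by exact: (measurable_fun_sub F_sigma).
have hg w : h w <= g w.
  by rewrite ler_piMr// -expR0 ler_expR oppr_le0 mulr_ge0.
have h_int : (\int[P]_(w in A) (h w)%:E < +oo)%E.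
  apply: le_lt_trans g_int; apply: ge0_le_integral => //.
  - by move=> w _; rewrite lee_fin.
  - exact: mAE.
  - exact: mAE.
  - by move=> w _; rewrite lee_fin.
under eq_integral => w _.
  rewrite addrC expRD expR_ln_bool// mulrA -/(h w).
  over.
apply: (le_trans (integral_reward_le h0 mh h_int)).
apply: ge0_le_integral => //.
- by move=> w _; rewrite lee_fin mulr_ge0// addr_ge0// mulr_ge0.
- apply: mAE; apply: measurable_funM => //; apply: measurable_funD => //.
  exact: measurable_funM.
- exact: mAE.
move=> w _; rewrite lee_fin /h -mulrA ler_piMr// mulrC expRN.
by rewrite ler_pdivrMr ?expR_gt0// mul1r expR_ge1Dx.
Qed.

Variables lambda x : T -> R.
Hypothesis t_le_lambda : forall w, t w <= lambda w.
Hypothesis lambda1 : forall w, lambda w <= 1.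
Hypothesis mlambda :
  measurable_fun (setT : set (g_sigma_algebraType F)) lambda.
Hypothesis x0 : forall w, 0 <= x w.
Hypothesis mx : measurable_fun (setT : set (g_sigma_algebraType F)) x.
Hypothesis reward_le_penalty :
  forall w, u * t w <= (1 - expR (- x w)) * (1 - lambda w).

(** [expR (- x)] is 1 minus the loss [1 - expR (- x)], which is incurred on
[lambda < X], an event of conditional probability at least [1 - lambda].  By
[reward_le_penalty] the expected loss outweighs the expected gain [u * t]. *)
Lemma supermartingale_step_adaptive :
  (\int[P]_(w in A)
     (g w * expR (ln (1 + u) * (X w <= t w)%R%:R
                  - x w * (lambda w < X w)%R%:R))%:E <=
   \int[P]_(w in A) (g w)%:E)%E.
Proof.
have mlT : measurable_fun setT lambda by exact: (measurable_fun_sub F_sigma).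
have mxT : measurable_fun setT x by exact: (measurable_fun_sub F_sigma).
have lambda0 w : 0 <= lambda w by exact: le_trans (t0 w) (t_le_lambda w).
pose v w := 1 - expR (- x w).
have v0 w : 0 <= v w by rewrite subr_ge0 -expR0 ler_expR oppr_le0.
have v1 w : v w <= 1 by rewrite lerBlDr lerDl expR_ge0.
have mv : measurable_fun (setT : set (g_sigma_algebraType F)) v.
  by apply: measurable_funB => //; do 2 apply: measurableT_comp => //.
have mgv : measurable_fun (setT : set (g_sigma_algebraType F)) (g \* v).
  exact: measurable_funM.
have mgvT : measurable_fun setT (g \* v) by exact: (measurable_fun_sub F_sigma).
have gv0 w : 0 <= (g \* v) w by rewrite mulr_ge0.
have gv_int : (\int[P]_(w in A) ((g \* v) w)%:E < +oo)%E.
  apply: le_lt_trans g_int; apply: ge0_le_integral => //.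
  - by move=> w _; rewrite lee_fin.
  - exact: mAE.
  - exact: mAE.
  - by move=> w _; rewrite lee_fin ler_piMr.
have mbt : measurable_fun setT (fun w => (X w <= t w)%R%:R : R).
  by apply: mbool; exact: measurable_fun_ler.
have mbl : measurable_fun setT (fun w => (lambda w < X w)%R%:R : R).
  by apply: mbool; exact: measurable_fun_ltr.
(* adding the loss to both sides keeps all integrands nonnegative *)
set pen := (\int[P]_(w in A) ((g \* v) w * (lambda w < X w)%R%:R)%:E)%E.
have pen0 : (0 <= pen)%E.
  by apply: integral_ge0 => w _; rewrite lee_fin mulr_ge0.
have pen_fin : pen \is a fin_num.
  rewrite ge0_fin_numE// (le_lt_trans _ gv_int)//; apply: ge0_le_integral => //.
  - by move=> w _; rewrite lee_fin mulr_ge0.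
  - by apply: mAE; exact: measurable_funM.
  - exact: mAE.
  by move=> w _; rewrite lee_fin ler_piMr//; case: (_ < _).
rewrite -(leeD2rE _ _ pen_fin) -ge0_integralD//; first last.
- by apply: mAE; exact: measurable_funM.
- by move=> w _; rewrite lee_fin mulr_ge0.
- apply: mAE; apply: measurable_funM => //; apply: measurableT_comp => //.
  by apply: measurable_funB; exact: measurable_funM.
- by move=> w _; rewrite lee_fin mulr_ge0// expR_ge0.
under eq_integral => w _.
  rewrite -EFinD.
  have -> : g w * expR (ln (1 + u) * (X w <= t w)%R%:R
        - x w * (lambda w < X w)%R%:R) + (g \* v) w * (lambda w < X w)%R%:R
      = g w * (1 + u * (X w <= t w)%R%:R).
    rewrite expRD expR_ln_bool// /v /=.
    case: (ltP (lambda w) (X w)) => lX.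
      rewrite leNgt (le_lt_trans (t_le_lambda w) lX)/= mulr0 addr0 mul1r !mulr1.
      by ring.
    by rewrite !mulr0 oppr0 expR0 mulr1 addr0.
  over.
apply: (le_trans (integral_reward_le g0 mg g_int)).
rewrite /pen -(integral_setI_bool P A (g \* v) (fun w => lambda w < X w)).
apply: le_trans (leeD2l _ (ge_integral_threshold F_sigma F_meas mX superuniform
  gv0 mgv lambda0 mlambda FA gv_int lambda1)).
rewrite -ge0_integralD//; first last.
- apply: mAE; apply: measurable_funM => //; exact: measurable_funB.
- by move=> w _; rewrite lee_fin mulr_ge0// subr_ge0.
- exact: mAE.
- by move=> w _; rewrite lee_fin.
apply: ge0_le_integral => //.
- by move=> w _; rewrite lee_fin mulr_ge0// addr_ge0// mulr_ge0.
- apply: mAE; apply: measurable_funM => //; apply: measurable_funD => //.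
  exact: measurable_funM.
- apply: (@mAE (fun w => g w + (g \* v) w * (1 - lambda w))).
  apply: measurable_funD => //.
  by apply: measurable_funM => //; exact: measurable_funB.
move=> w _; rewrite -EFinD lee_fin mulrDr mulr1 lerD2l /= -mulrA ler_wpM2l//.
Qed.

End OneStep.

(** * From the supermartingale to the false discovery proportion *)

Lemma cond_prob_le_set d (T : measurableType d) (R : realType)
    (P : probability T R) (F : set (set T)) (E : set T) (s : R) (A : set T) :
  F `<=` measurable -> 0 <= s -> cond_prob_le P F E s -> F A ->
  (P (A `&` E) <= s%:E * P A)%E.
Proof.
move=> F_meas s0 [q [_ qint qE] qs] FA.
have mA : measurable A by exact: F_meas.
have mq : measurable_fun A (EFin \o q).
  by apply: measurable_funTS; exact: measurable_int qint.
rewrite setIC -qE// -integral_cst// [leLHS]integralE.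
apply: (@le_trans _ _ (\int[P]_(w in A) ((EFin \o q)^\+ w))%E).
  rewrite -[leRHS]sube0 leeB//; apply: integral_ge0 => w _; exact: funeneg_ge0.
apply: ae_ge0_le_integral => //.
- exact: measurable_funepos.
- apply: filterS qs => w qs _ /=.
  by rewrite funeposE/= ge_max !lee_fin qs s0.
Qed.

(** Levels [s > 1] satisfy the bound trivially; including them lets it be applied
to thresholds that may exceed 1. *)
Lemma superuniform_set d (T : measurableType d) (R : realType)
    (P : probability T R) (F : set (set T)) (X : T -> R) :
  F `<=` measurable -> measurable_fun setT X ->
  (forall s : R, 0 <= s <= 1 -> cond_prob_le P F [set w | X w <= s] s) ->
  forall s : R, 0 <= s -> forall A, F A ->
  (P (A `&` [set w | (X w <= s)%R]) <= s%:E * P A)%E.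
Proof.
move=> F_meas mX Xs s s0 A FA; case: (leP s 1) => s1.
  by apply: (cond_prob_le_set F_meas) => //; apply: Xs; rewrite s0.
have mA : measurable A by exact: F_meas.
have mXs : measurable [set w | X w <= s].
  by rewrite -[X in measurable X]setTI; exact: measurable_fun_le.
apply: (@le_trans _ _ (P A)).
  by apply: le_measure; rewrite ?inE//; exact: measurableI.
by rewrite -[leLHS]mul1e lee_wpmul2r// lee_fin ltW.
Qed.

(** Multiplying by the number of rejections turns the left-hand side into the
count of false rejections, an integer, so that the floor may be dropped.  When
nothing is rejected both sides are true, thanks to [0 <= y]. *)
Lemma FDP_le_floorE (T : Type) (R : realType) (H0 : set nat)
    (p alpha : nat -> T -> R) k w (y : R) : 0 <= y ->
  ((FDP H0 (rejections p alpha k w) : R)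
     <= (Num.floor y)%:~R / #|rejections p alpha k w|%:R)
  = (\sum_(j < k) ((j : nat) \in H0)%:R * (p j w <= alpha j w)%R%:R <= y).
Proof.
move=> y0.
set rej := rejections p alpha k w.
set V := #|[set j in rej | (j : nat) \in H0]%SET|.
have -> : \sum_(j < k) ((j : nat) \in H0)%:R * (p j w <= alpha j w)%R%:R
          = V%:R :> R.
  rewrite /V -sum1_card natr_sum [RHS]big_mkcond/=; apply: eq_bigr => j _.
  rewrite !inE andbC; case: (_ \in H0); rewrite ?mul0r//= mul1r.
  by case: (_ <= _).
rewrite /FDP -/V.
have [rej0|rej_gt0] := posnP #|rej|.
  have -> : V = 0%N.
    apply/eqP; rewrite -leqn0 -rej0; apply: subset_leq_card.
    by apply/fintype.subsetP => j; rewrite inE => /andP[].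
  by rewrite rej0 invr0 !mulr0 lexx y0.
by rewrite ler_pM2r ?invr_gt0 ?ltr0n// pmulrn ler_int floor_ge_int.
Qed.

Section OnlineBound.
Context d (T : measurableType d) (R : realType) (P : probability T R).
Variables (H0 : set nat) (p : nat -> {RV P >-> R}) (alpha : nat -> T -> R).
Variable G : nat -> set (set T).
Hypothesis G_filtration : filtration G.
Hypothesis G_rejections : forall j k, (j < k)%N ->
  measurable_wrt (G k) (\1_[set w | p j w <= alpha j w] : T -> R).

Let G_sigma k : sigma_algebra setT (G k).
Proof. by case: G_filtration. Qed.
Let G_meas k : G k `<=` measurable.
Proof. by case: G_filtration. Qed.

Lemma measurable_wrt_bool k (b : T -> bool) :
  measurable_wrt (G k) (\1_[set w | b w] : T -> R) ->
  measurable_fun (setT : set (g_sigma_algebraType (G k)))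
    (fun w => (b w)%:R : R).
Proof.
move=> /(measurable_wrtP (@G_sigma k)).
rewrite (_ : (\1_[set w | b w] : T -> R) = fun w => (b w)%:R)//.
apply/funext => w; rewrite indicE.
by have -> : (w \in [set w | b w]) = b w by apply/idP/idP; rewrite inE.
Qed.

Variables (theta conf : R) (penalty : nat -> T -> R) (y : nat -> T -> R).
Hypothesis conf01 : 0 < conf < 1.
Hypothesis penalty_ge0 : forall j w, 0 <= penalty j w.
Hypothesis m_penalty : forall j k, (j < k)%N ->
  measurable_fun (setT : set (g_sigma_algebraType (G k))) (penalty j).
Hypothesis step : forall k, k \in H0 -> forall (g : T -> R) A, G k A ->
  (forall w, 0 <= g w) ->
  measurable_fun (setT : set (g_sigma_algebraType (G k))) g ->
  (\int[P]_(w in A) (g w)%:E < +oo)%E ->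
  (\int[P]_(w in A)
     (g w * expR (theta * (p k w <= alpha k w)%R%:R - penalty k w))%:E <=
   \int[P]_(w in A) (g w)%:E)%E.
Hypothesis y_ge0 : forall k w, 0 <= y k w.
Hypothesis my : forall k, measurable_fun setT (y k).
Hypothesis y_bound : forall k w (n : nat),
  theta * n%:R < ln (1 / conf) + \sum_(j < k) penalty j w -> n%:R <= y k w.

(** The sum in Ville's inequality has a zero increment at non-null indices, whereas
[y_bound] sums the penalties over all indices: this is where the penalties have
to be nonnegative. *)
Lemma online_bound :
  ((1 - conf)%:E <=
    P [set w | forall k, ((FDP H0 (rejections p alpha k w) : R) <=
      (Num.floor (y k w))%:~R / #|rejections p alpha k w|%:R)%R])%E.
Proof.
have /andP[conf0 conf1] := conf01.
pose V k w : R :=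
  \sum_(j < k) ((j : nat) \in H0)%:R * (p j w <= alpha j w)%R%:R.
have -> : [set w | forall k, ((FDP H0 (rejections p alpha k w) : R) <=
      (Num.floor (y k w))%:~R / #|rejections p alpha k w|%:R)%R]
    = [set w | forall k, V k w <= y k w].
  by apply/seteqP; split=> w /= h k; move: (h k); rewrite FDP_le_floorE.
have mind j k : (j < k)%N -> measurable_fun
    (setT : set (g_sigma_algebraType (G k)))
    (fun w => (p j w <= alpha j w)%R%:R : R).
  by move=> jk; exact: measurable_wrt_bool (G_rejections jk).
have mV k : measurable_fun setT (V k).
  apply: measurable_sum => j; apply: measurable_funM => //.
  have := mind _ _ (ltn_ord j).
  exact: (measurable_fun_sub (@G_sigma k) (@G_meas k)).
have mVy : measurable [set w | forall k, V k w <= y k w].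
  rewrite (_ : [set w | _] = \bigcap_k [set w | V k w <= y k w]).
    apply: bigcapT_measurable => k; rewrite -[X in measurable X]setTI.
    exact: measurable_fun_le.
  by apply/seteqP; split=> [w h k _|w h k]; [exact: h|exact: (h k I)].
pose Y j w := if j \in H0
  then theta * (p j w <= alpha j w)%R%:R - penalty j w else 0.
have mY j k : (j < k)%N ->
    measurable_fun (setT : set (g_sigma_algebraType (G k))) (Y j).
  move=> jk; rewrite /Y; case: (j \in H0) => //.
  by apply: measurable_funB;
    [apply: measurable_funM => //; exact: mind|exact: m_penalty].
pose L := ln (1 / conf).
have L_gt0 : 0 < L by rewrite ln_gt0// ltr_pdivlMr ?mul1r.
have expL : expR (- L) = conf by rewrite /L div1r lnV// opprK lnK.
have stepY k (g : T -> R) A : G k A -> (forall w, 0 <= g w) ->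
    measurable_fun (setT : set (g_sigma_algebraType (G k))) g ->
    (\int[P]_(w in A) (g w)%:E < +oo)%E ->
    (\int[P]_(w in A) (g w * expR (Y k w))%:E <= \int[P]_(w in A) (g w)%:E)%E.
  rewrite /Y; case: (boolP (k \in H0)) => kH0; first exact: step.
  by move=> *; under eq_integral do rewrite expR0 mulr1.
rewrite -[X in (1 - X)%:E]expL.
apply: (le_trans (ville G_filtration mY stepY L_gt0)).
apply: le_measure; rewrite ?inE//.
  exact: (measurable_below_all G_filtration mY).
move=> w /= Yw k.
have [n Vn] : exists n : nat, V k w = n%:R.
  exists (\sum_(j < k) ((j : nat) \in H0) * (p j w <= alpha j w)%R)%N.
  by rewrite natr_sum; apply: eq_bigr => j _; rewrite natrM.
rewrite Vn; apply: y_bound; rewrite -Vn -ltrBlDr.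
apply: le_lt_trans (Yw k).
rewrite mulr_sumr -sumrB; apply: ler_sum => j _; rewrite /Y.
case: (_ \in H0); first by rewrite mul1r.
by rewrite mul0r mulr0 sub0r oppr_le0.
Qed.

End OnlineBound.

(** * The two bounds *)

(** The concave function [1 - expR (- (b * x))], which vanishes at 0, lies above
its chord on [0, B]. *)
Lemma chord_le_1BexpR (R : realType) (b B x : R) : 0 < B -> 0 <= x <= B ->
  x * ((1 - expR (- (b * B))) / B) <= 1 - expR (- (b * x)).
Proof.
move=> B0 /andP[x0 xB].
have r0 : 0 <= x / B by rewrite divr_ge0// ltW.
have r1 : x / B <= 1 by rewrite ler_pdivrMr ?mul1r.
have := convex_expR (Itv01 r0 r1) (- (b * B)) 0.
rewrite !convRE/= /unstable.onem expR0 mulr0 addr0 mulr1.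
have -> : x / B * - (b * B) = - (b * x).
  by rewrite mulrN mulrACA [x * b]mulrC mulVf ?mulr1// gt_eqF.
move=> h; rewrite mulrCA mulrC mulrDr mulr1 mulrN; lra.
Qed.

Theorem theorem4 (d : measure_display) (T : measurableType d) (R : realType)
    (P : probability T R)
    (H0 : set nat) (p : nat -> {RV P >-> R})
    (p01 : forall j w, 0 <= p j w <= 1)
    (a : R) (a_gt0 : 0 < a)
    (G : nat -> set (set T)) (G_filtration : filtration G)
    (alpha : nat -> T -> R)
    (alpha_ge0 : forall j w, 0 <= alpha j w)
    (alpha_predictable : predictable G alpha)
    (G_rejections : forall j k, (j < k)%N ->
       measurable_wrt (G k) (\1_[set w | p j w <= alpha j w] : T -> R))
    (null_superuniform : forall k, H0 k -> forall s : R, 0 <= s <= 1 ->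
       cond_prob_le P (G k) [set w | p k w <= s] s) :
  (forall conf : R, 0 < conf < 1 ->
     ((1 - conf)%:E <=
       P [set w | forall k, (FDP H0 (rejections p alpha k w)
                            <= FDPbar_simple a conf p alpha k w)%R])%E)
  /\
  (forall (lambda : nat -> T -> R) (B : R),
     (forall j w, alpha j w <= lambda j w) ->
     (forall j w, lambda j w < 1) ->
     predictable G lambda ->
     (* the past also contains the indicators entering the bound *)
     (forall j k, (j < k)%N ->
        measurable_wrt (G k) (\1_[set w | lambda j w < p j w] : T -> R)) ->
     ereal_sup [set (alpha jw.1 jw.2 / (1 - lambda jw.1 jw.2))%:E
               | jw in [set: nat * T]] = B%:E ->
     forall conf : R, 0 < conf < 1 ->
     ((1 - conf)%:E <=
       P [set w | forall k, (FDP H0 (rejections p alpha k w)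
                            <= FDPbar_adaptive a B conf p alpha lambda k w)%R])%E).
Proof.
have [G_sigma G_meas G_le] := G_filtration.
have malpha j k : (j <= k)%N ->
    measurable_fun (setT : set (g_sigma_algebraType (G k))) (alpha j).
  move=> jk; apply/(measurable_wrtP (G_sigma k)).
  by apply: subset_trans (G_le _ _ jk); exact: alpha_predictable.
have malphaT j : measurable_fun setT (alpha j).
  exact: (measurable_fun_sub (G_sigma j) (G_meas j) (malpha j j (leqnn j))).
have superuniform k : k \in H0 -> forall s : R, 0 <= s -> forall A, G k A ->
    (P (A `&` [set w | (p k w <= s)%R]) <= s%:E * P A)%E.
  move=> /set_mem kH0; apply: superuniform_set => //.
  exact: null_superuniform.
split.
  move=> conf conf01; have /andP[conf0 conf1] := conf01.
  pose L := ln (1 / conf).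
  have L_gt0 : 0 < L by rewrite ln_gt0// ltr_pdivlMr ?mul1r.
  pose u := L / a.
  have u_gt0 : 0 < u by rewrite divr_gt0.
  have th_gt0 : 0 < ln (1 + u) by rewrite ln_gt0// ltrDl.
  apply: (@online_bound _ _ _ P H0 p alpha G G_filtration G_rejections
    (ln (1 + u)) conf (fun j w => u * alpha j w)
    (fun k w => L / (a * ln (1 + u)) * (a + \sum_(j < k) alpha j w))) => //.
  - by move=> j w; rewrite mulr_ge0// ltW.
  - by move=> j k jk; apply: measurable_funM => //; apply: malpha; exact: ltnW.
  - move=> k kH0 g A GA g0 mg g_int.
    apply: (supermartingale_step_simple (G_sigma k) (G_meas k) _
      (superuniform k kH0)) => //; first exact: malpha.
    exact: ltW.
  - move=> k w; rewrite mulr_ge0//; first by rewrite divr_ge0 ?mulr_ge0 ?ltW.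
    by rewrite addr_ge0 ?(ltW a_gt0)// sumr_ge0.
  - move=> k; apply: measurable_funM => //; apply: measurable_funD => //.
    by apply: measurable_sum.
  move=> k w n; rewrite -mulr_sumr mulrC -ltr_pdivlMr// => /ltW h.
  apply: (le_trans h); rewrite le_eqVlt; apply/orP; left; apply/eqP.
  by rewrite -/L /u; field; rewrite (gt_eqF a_gt0) (gt_eqF th_gt0).
move=> lambda B alpha_le_lambda lambda_lt1 lambda_pred G_penalty supB.
move=> conf conf01; have /andP[conf0 conf1] := conf01.
pose L := ln (1 / conf).
have L_gt0 : 0 < L by rewrite ln_gt0// ltr_pdivlMr ?mul1r.
have lambda_le1 j w : 0 < 1 - lambda j w by rewrite subr_gt0.
pose x j w := alpha j w / (1 - lambda j w).
have x_ge0 j w : 0 <= x j w by rewrite divr_ge0// ltW.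
have x_leB j w : x j w <= B.
  by rewrite -lee_fin -supB; apply: ereal_sup_ubound; exists (j, w).
have B_ge0 : 0 <= B by exact: le_trans (x_ge0 0%N point) (x_leB _ _).
have mlambda j k : (j <= k)%N ->
    measurable_fun (setT : set (g_sigma_algebraType (G k))) (lambda j).
  move=> jk; apply/(measurable_wrtP (G_sigma k)).
  by apply: subset_trans (G_le _ _ jk); exact: lambda_pred.
have mx j k : (j <= k)%N ->
    measurable_fun (setT : set (g_sigma_algebraType (G k))) (x j).
  move=> jk; apply: measurable_funM; first exact: malpha.
  rewrite (_ : (fun w => _) = (fun w => (1 - lambda j w) `^ (-1))).
    apply: (measurableT_comp (measurable_powR (-1))).
    by apply: measurable_funB => //; exact: mlambda.
  by apply/funext => w; rewrite powR_inv1// ltW.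
have mind j k : (j < k)%N -> measurable_fun
    (setT : set (g_sigma_algebraType (G k)))
    (fun w => (lambda j w < p j w)%R%:R : R).
  by move=> jk; exact: (measurable_wrt_bool G_filtration (G_penalty _ _ jk)).
pose b := L / a.
have b_ge0 : 0 <= b by rewrite divr_ge0 ?ltW.
have confB : conf `^ (B / a) = expR (- (b * B)).
  rewrite /powR gt_eqF// /b /L div1r lnV//; congr expR; ring.
pose c := (1 - conf `^ (B / a)) / B.
have c_ge0 : 0 <= c.
  by rewrite /c confB divr_ge0// subr_ge0 -expR0 ler_expR oppr_le0 mulr_ge0.
pose y k w := L / (a * ln (1 + c)) *
  (a + \sum_(j < k) alpha j w / (1 - lambda j w) * (lambda j w < p j w)%R%:R).
(* [u] is [c], unless [B = 0], where [c = 0 / 0 = 0] gives [theta = 0] *)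
suff [u [u_gt0 u_reward u_bound]] : exists u, [/\ 0 < u,
    forall j w, u * alpha j w <= (1 - expR (- (b * x j w))) * (1 - lambda j w)
  & forall k w (n : nat), ln (1 + u) * n%:R <
      L + \sum_(j < k) b * x j w * (lambda j w < p j w)%R%:R -> n%:R <= y k w].
  apply: (@online_bound _ _ _ P H0 p alpha G G_filtration G_rejections
    (ln (1 + u)) conf (fun j w => b * x j w * (lambda j w < p j w)%R%:R) y)
    => //.
  - by move=> j w; apply: mulr_ge0 => //; exact: mulr_ge0.
  - move=> j k jk; apply: measurable_funM; last exact: mind.
    by apply: measurable_funM => //; apply: mx; exact: ltnW.
  - move=> k kH0 g A GA g0 mg g_int.
    apply: (supermartingale_step_adaptive (G_sigma k) (G_meas k) _
      (superuniform k kH0) _ _ _ _ _ _ _ (alpha_le_lambda k)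
      _ _ _ _ (u_reward k)) => //.
    + exact: malpha.
    + exact: ltW.
    + by move=> w; exact: ltW.
    + exact: mlambda.
    + by move=> w; rewrite mulr_ge0.
    + by apply: measurable_funM => //; exact: mx.
  - move=> k w; rewrite mulr_ge0//.
      by rewrite divr_ge0 ?(ltW L_gt0)// mulr_ge0 ?(ltW a_gt0)// ln_ge0// lerDl.
    rewrite addr_ge0 ?(ltW a_gt0)// sumr_ge0// => j _.
    by rewrite mulr_ge0//; exact: x_ge0.
  - move=> k; apply: (measurable_fun_sub (G_sigma k) (G_meas k)).
    apply: measurable_funM => //; apply: measurable_funD => //.
    apply: measurable_sum => j; apply: measurable_funM.
      by apply: mx; exact: ltnW.
    exact: mind.
(* If [B = 0] then all thresholds and penalties vanish and any positive reward
   is affordable; with [theta = L] the bound reads [L * n < L], so [n = 0]. *)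
have [B0|B_neq0] := eqVneq B 0.
  have x0 j w : x j w = 0.
    by apply/eqP; rewrite eq_le x_ge0 andbT -B0.
  have alpha0 j w : alpha j w = 0.
    by apply/eqP; rewrite -(divrK (unitf_gt0 (lambda_le1 j w)) (alpha j w));
      rewrite -/(x j w) x0 mul0r.
  exists (expR L - 1); split.
  - by rewrite subr_gt0 -expR0 ltr_expR.
  - by move=> j w; rewrite alpha0 x0 !mulr0 oppr0 expR0 subrr mul0r.
  move=> k w n; rewrite addrC subrK expRK big1 => [|j _]; last first.
    by rewrite x0 mulr0 mul0r.
  rewrite addr0 gtr_pMr// ltrn1 ltnS leqn0 => /eqP->.
  by rewrite /y /c B0 invr0 mulr0 addr0 ln1 mulr0 invr0 mulr0 mul0r.
have B_gt0 : 0 < B by rewrite lt_neqAle eq_sym B_neq0.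
have c_gt0 : 0 < c.
  rewrite /c confB divr_gt0// subr_gt0 -expR0 ltr_expR oppr_lt0.
  by rewrite mulr_gt0// divr_gt0.
have th_gt0 : 0 < ln (1 + c) by rewrite ln_gt0// ltrDl.
exists c; split=> // [j w|k w n].
  have -> : c * alpha j w = x j w * c * (1 - lambda j w).
    by rewrite mulrC /x mulrAC divfK// gt_eqF.
  rewrite ler_wpM2r ?(ltW (lambda_le1 j w))// /c confB chord_le_1BexpR//.
  by rewrite x_ge0 x_leB.
under eq_bigr do rewrite -mulrA.
rewrite -mulr_sumr mulrC -ltr_pdivlMr// => /ltW h.
apply: (le_trans h); rewrite le_eqVlt; apply/orP; left; apply/eqP.
by rewrite -/L /y /b; field; rewrite (gt_eqF a_gt0) (gt_eqF th_gt0).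
Qed.
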